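(* Let $\Omega\subset\mathbb H^2$ be a bounded smooth horoconvex domain and let $\psi\in C^1(\overline\Omega)$ satisfy $\psi>0$ in $\Omega$, and $\psi=0$ and $\nabla\psi\neq0$ on $\partial\Omega$. Let $K\not\equiv0$ be a Killing field on $\mathbb H^2$ with $I_K>0$. Then $K(\psi)$ has exactly two zeros on $\partial\Omega$.
   Context: $\mathbb H^2$ is the hyperbolic plane with its metric of constant curvature $-1$, with a fixed orientation, and $J$ denotes rotation by $\pi/2$ in the tangent planes. A horoball in $\mathbb H^2$ is a closed sublevel set $\{b\le c\}$ of a Busemann function $b$. A bounded smooth domain (bounded connected open set with smooth boundary) $\Omega\subset\mathbb H^2$ is horoconvex if its closure is an intersection of horoballs. For a Killing field $K$ on $\mathbb H^2$ there is a unique smooth function $\omega$ with $\nabla_XK=\omega\,JX$ for all tangent vectors $X$, and the quantity $I_K:=|K|^2-\omega^2$ is constant on $\mathbb H^2$. $K(\psi)=\langle K,\nabla\psi\rangle$ is the derivative of $\psi$ along $K$. *)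

(* Defs.v *)
From HB Require Import structures.
From mathcomp Require Import all_boot all_order all_algebra.
From mathcomp Require Import all_classical all_reals all_analysis.

Set Implicit Arguments.
Unset Strict Implicit.
Unset Printing Implicit Defensive.

Import Order.TTheory GRing.Theory Num.Theory.
Import numFieldNormedType.Exports.

Local Open Scope classical_set_scope.
Local Open Scope ring_scope.

(* The hyperbolic plane is the upper half-plane {y > 0} with the metric
   (dx^2 + dy^2) / y^2 and the standard orientation.  Points and tangent
   vectors are pairs of coordinates; functions and vector fields are total on
   R * R, but only their values on the half-plane are ever constrained. *)
Definition halfplane (R : realType) : set (R * R) := [set p | 0 < p.2].

Definition metric (R : realType) (p X Y : R * R) : R :=
  (X.1 * Y.1 + X.2 * Y.2) / p.2 ^+ 2.

Definition rot (R : realType) (X : R * R) : R * R := (- X.2, X.1).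

Definition arcosh (R : realType) (u : R) : R := ln (u + Num.sqrt (u ^+ 2 - 1)).

Definition hdist (R : realType) (p q : R * R) : R :=
  arcosh (1 + ((p.1 - q.1) ^+ 2 + (p.2 - q.2) ^+ 2) / (2 * p.2 * q.2)).

(* C^k and C^oo on an open set U. *)
Fixpoint Ck (R : realType) (k : nat) (U : set (R * R)) (f : R * R -> R) : Prop :=
  match k with
  | 0%N => forall p, U p -> {for p, continuous f}
  | k'.+1 => [/\ forall p, U p -> differentiable f p,
                 Ck k' U (fun p => 'D_((1, 0) : R * R) f p)
               & Ck k' U (fun p => 'D_((0, 1) : R * R) f p)]
  end.

Definition smooth_on (R : realType) (U : set (R * R)) (f : R * R -> R) : Prop :=
  forall k, Ck k U f.

(* Levi-Civita derivative (nabla_X K)(p): the nonzero Christoffel symbols are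
   G^x_xy = G^x_yx = G^y_yy = - 1 / y and G^y_xx = 1 / y. *)
Definition nabla (R : realType) (X : R * R) (K : R * R -> R * R) (p : R * R) :
    R * R :=
  ('D_X (fun q => (K q).1) p - (X.1 * (K p).2 + X.2 * (K p).1) / p.2,
   'D_X (fun q => (K q).2) p + (X.1 * (K p).1 - X.2 * (K p).2) / p.2).

Definition killing (R : realType) (K : R * R -> R * R) : Prop :=
  [/\ smooth_on (@halfplane R) (fun p => (K p).1),
      smooth_on (@halfplane R) (fun p => (K p).2)
    & forall p X Y, halfplane p ->
        metric p (nabla X K p) Y + metric p X (nabla Y K p) = 0].

(* omega is the function with nabla_X K = omega J X; it is determined by K. *)
Definition rotation_function (R : realType) (K : R * R -> R * R)
    (omega : R * R -> R) : Prop :=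
  forall p X, halfplane p -> nabla X K p = omega p *: rot X.

Definition killing_invariant (R : realType) (K : R * R -> R * R)
    (omega : R * R -> R) (p : R * R) : R :=
  metric p (K p) (K p) - omega p ^+ 2.

(* Unit-speed geodesic rays, as isometric embeddings of [0, +oo[. *)
Definition geodesic_ray (R : realType) (gamma : R -> R * R) : Prop :=
  (forall t, 0 <= t -> halfplane (gamma t)) /\
  (forall s t, 0 <= s -> 0 <= t -> hdist (gamma s) (gamma t) = `|s - t|).

Definition busemann (R : realType) (b : R * R -> R) : Prop :=
  exists2 gamma : R -> R * R, geodesic_ray gamma &
    forall p, halfplane p -> (hdist p (gamma t) - t) @[t --> +oo] --> b p.

Definition horoball (R : realType) (B : set (R * R)) : Prop :=
  exists2 b : R * R -> R, busemann b &
    exists c : R, B = [set p | halfplane p /\ b p <= c].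

Definition bdry (R : realType) (A : set (R * R)) : set (R * R) :=
  closure A `\` A°.

(* Locally, the set is the negative side of a smooth function whose
   differential does not vanish. *)
Definition smooth_boundary (R : realType) (Omega : set (R * R)) : Prop :=
  forall p, bdry Omega p ->
    exists U : set (R * R), exists rho : R * R -> R,
      [/\ open U, U p, smooth_on U rho,
          forall q, U q -> exists X, 'D_X rho q != 0
        & Omega `&` U = [set q | U q /\ rho q < 0]].

(* Boundedness is for the hyperbolic distance, so that the closure in R * R of
   such a domain is contained in the half-plane and is its closure there. *)
Definition bounded_smooth_domain (R : realType) (Omega : set (R * R)) : Prop :=
  [/\ Omega `<=` @halfplane R, open Omega, connected Omega, Omega !=set0
    & (exists r : R, forall p q, Omega p -> Omega q -> hdist p q <= r) /\
      smooth_boundary Omega].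

Definition horoconvex (R : realType) (Omega : set (R * R)) : Prop :=
  exists2 F : set (set (R * R)), (forall B, F B -> horoball B) &
    closure Omega = \bigcap_(B in F) B.

(* psi is C^1 on the closure of Omega, with Riemannian gradient grad: psi is
   differentiable in Omega, and psi and its gradient extend continuously to the
   closure.  On the boundary, grad is this extension, hence determined by psi. *)
Definition C1_closure (R : realType) (Omega : set (R * R)) (psi : R * R -> R)
    (grad : R * R -> R * R) : Prop :=
  [/\ {within closure Omega, continuous psi},
      {within closure Omega, continuous grad}
    & forall p, Omega p -> differentiable psi p /\
        forall X, 'd psi p X = metric p (grad p) X].

(* The function K(psi) = <K, nabla psi>. *)
Definition derivative_along (R : realType) (K grad : R * R -> R * R)
    (p : R * R) : R :=
  metric p (K p) (grad p).

(* Main.v *)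
Require Import Defs.
From mathcomp Require Import all_boot all_order all_algebra.
From mathcomp Require Import all_classical all_reals all_analysis.
From mathcomp Require Import ring lra.
Import Order.TTheory GRing.Theory Num.Theory.
Import numFieldNormedType.Exports.
Local Open Scope classical_set_scope.
Local Open Scope ring_scope.

Set Implicit Arguments.
Unset Strict Implicit.
Unset Printing Implicit Defensive.

(** In the half-plane the linear forms of the hyperboloid model become the
    functions linform a b c p = (a |p|^2 + b p.1 + c) / p.2, and everything in
    the statement is described by them.  A Killing field is K = a z^2 + b z + c
    in the complex coordinate, with I_K = b^2 - 4 a c (killing_field_quadratic);
    it is tangent to the level curves of f = linform a b c, which has no critical
    point when I_K > 0.  The exponential of a Busemann function is a linear form
    h whose coefficient vector is null (busemann_linform), so horoballs are
    sublevel sets of null forms.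

    Since psi vanishes on the boundary and is positive inside, its gradient is a
    nonzero normal vector there (gradient_inward and halfplane_duality).  Hence
    K(psi) vanishes at a boundary point p exactly when K is tangent to the
    boundary, that is, when the gradient of f is normal: the zeros of K(psi) are
    the critical points of f on the boundary.

    At such a p there is a horoball that contains the closure of the domain and
    has p on its boundary (supporting_horoball).  Its null form h is maximal at
    p, so its gradient is normal as well and equals l times that of f.  The
    level curve of f through p and the horocycle are then tangent, and because
    the horocycle is more curved (geodesic curvature 1 against less than 1), l f
    is strictly smaller on the rest of the horoball than at p
    (tangent_horocycle_extremum).  So each zero of K(psi) is a strict global
    maximum or minimum point of f on the closure, of which there is at most one
    each.  Conversely f attains its maximum and its minimum on the compact
    closure, at boundary points because it has no critical point, and these are
    zeros of K(psi); they differ since f is not constant on the domain. *)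

(** * Plane vectors *)

Lemma scale_pairE (R : realType) (c x y : R) : c *: (x, y) = (c * x, c * y).
Proof. by []. Qed.

(** The Riemannian metric of the half-plane is conformal to this form, so angles,
    orthogonality and the sign of a derivative can be read off from it. *)
Definition dot (R : realType) (X Y : R * R) : R := X.1 * Y.1 + X.2 * Y.2.

Lemma dotZr (R : realType) (k : R) (X Y : R * R) : dot X (k *: Y) = k * dot X Y.
Proof. by case: X Y => [x1 x2] [y1 y2]; rewrite scale_pairE /dot /=; ring. Qed.

Lemma dot_gt0 (R : realType) (X : R * R) : X != 0 -> 0 < dot X X.
Proof.
case: X => x y Hxy; rewrite /dot /= -!expr2.
have : ~~ ((x == 0) && (y == 0)) by apply: contra Hxy => /andP[/eqP-> /eqP->].
rewrite negb_and => /orP[] h.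
  by rewrite ltr_pwDl ?sqr_ge0 // exprn_even_gt0.
by rewrite ltr_pwDr ?sqr_ge0 // exprn_even_gt0.
Qed.

(** Dimension two: the orthogonal complement of a nonzero vector is a line. *)
Lemma dot_orthogonal_parallel (R : realType) (V X Y : R * R) :
  V != 0 -> X != 0 -> dot V X = 0 -> dot V Y = 0 -> exists l, Y = l *: X.
Proof.
move=> /dot_gt0 V0 /dot_gt0 X0 VX VY.
have det0 : X.1 * Y.2 - X.2 * Y.1 = 0.
  have : dot V V * (X.1 * Y.2 - X.2 * Y.1) = 0.
    have -> : dot V V * (X.1 * Y.2 - X.2 * Y.1) =
      dot V X * (V.1 * Y.2 - V.2 * Y.1) - dot V Y * (V.1 * X.2 - V.2 * X.1).
      rewrite /dot; ring.
    by rewrite VX VY !mul0r subr0.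
  by move/eqP; rewrite mulf_eq0 gt_eqF //= => /eqP.
have XX0 : dot X X != 0 by rewrite gt_eqF.
exists (dot X Y / dot X X); case: X Y det0 XX0 {X0 VX VY} => [x1 x2] [y1 y2].
rewrite /dot /= => det0 XX0; rewrite scale_pairE.
congr (_, _).
  apply/eqP; rewrite -subr_eq0; apply/eqP.
  transitivity (- x2 * (x1 * y2 - x2 * y1) / (x1 * x1 + x2 * x2)); first by field.
  by rewrite det0 mulr0 mul0r.
apply/eqP; rewrite -subr_eq0; apply/eqP.
transitivity (x1 * (x1 * y2 - x2 * y1) / (x1 * x1 + x2 * x2)); first by field.
by rewrite det0 mulr0 mul0r.
Qed.

(** A linear form that is nonpositive on an open half-plane is a multiple of the
    form defining it: its kernel must be the bounding line.  A first-order
    condition along all inward directions thus determines a gradient up to a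
    factor. *)
Lemma halfplane_duality (R : realType) (n m : R * R) : n != 0 ->
  (forall V, dot n V < 0 -> dot m V <= 0) -> exists l, m = l *: n.
Proof.
move=> n0 nm; have nn := dot_gt0 n0.
have rot0 : Defs.rot n != 0.
  apply: contraTneq nn => rn0; rewrite -leNgt; move: rn0.
  case: (n) => x y [/eqP]; rewrite oppr_eq0 => /eqP -> ->.
  by rewrite /dot /= !mulr0 addr0.
apply: (dot_orthogonal_parallel rot0 n0); first by rewrite /Defs.rot /dot /=; ring.
apply/eqP/negPn/negP => d0; set d := dot (Defs.rot n) m in d0.
set e := dot m n.
(* moving along the bounding line by d and inward by this small s gives a
   vector on which m is positive *)
set s := d ^+ 2 / (`|e| + 1).
have e1 : 0 < `|e| + 1 by rewrite ltr_pwDr.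
have d2 : 0 < d ^+ 2 by rewrite exprn_even_gt0.
have s0 : 0 < s by rewrite divr_gt0.
have /nm : dot n (d *: Defs.rot n - s *: n) < 0.
  have -> : dot n (d *: Defs.rot n - s *: n) = - (s * dot n n).
    by case: (n) => x y; rewrite /Defs.rot !scale_pairE /dot /=; ring.
  by rewrite oppr_lt0 mulr_gt0.
have -> : dot m (d *: Defs.rot n - s *: n) = d ^+ 2 - s * e.
  rewrite expr2 /e {2}/d.
  by case: (n) => x y; rewrite /Defs.rot !scale_pairE /dot /=; ring.
rewrite subr_le0 leNgt => /negP; apply.
apply: (le_lt_trans (ler_norm _)); rewrite normrM (gtr0_norm s0).
rewrite /s mulrAC ltr_pdivrMr // ltr_pM2l //; lra.
Qed.

(** * Derivatives along lines *)

Lemma is_derive_line (R : realType) (F : R * R -> R) (p V : R * R) (t : R) :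
  differentiable F (p + t *: V) ->
  is_derive t 1 (fun s => F (p + s *: V)) ('D_V F (p + t *: V)).
Proof.
move=> dF; have E : (fun h : R => h^-1 *:
      (((fun s => F (p + s *: V)) \o shift t) (h *: 1) - F (p + t *: V))) =
    (fun h => h^-1 *: ((F \o shift (p + t *: V)) (h *: V) - F (p + t *: V))).
  apply/funext => h /=; congr (_ *: (F _ - _)).
  by rewrite [h%:A]mulr1 scalerDl addrCA.
have := @diff_derivable _ _ _ F _ V dF; rewrite /derivable -E => dFV.
by apply: DeriveDef => //; rewrite /derive E.
Qed.

Lemma derive0_eq (R : realType) (f : R -> R) (s t : R) : s <= t ->
  (forall x, s <= x <= t -> is_derive x 1 f 0) -> f s = f t.
Proof.
move=> st df; apply/esym/eqP; rewrite -subr_eq0.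
have dfo x : x \in `]s, t[%R -> is_derive x 1 f 0.
  by rewrite in_itv /= => /andP[sx xt]; apply: df; rewrite !ltW.
have cf : {within `[s, t], continuous f}.
  by apply: derivable_within_continuous => x; rewrite in_itv /= => /df [].
by have [c _ ->] := @MVT_segment R f (fun=> 0) s t st dfo cf; rewrite mul0r.
Qed.

Lemma cvg_line (R : realType) (p V : R * R) : (p + t *: V) @[t --> 0^'+] --> p.
Proof.
apply: cvg_at_right_filter.
rewrite -[X in _ --> X]addr0 -[X in _ --> p + X](scale0r V).
by apply: cvgD; [exact: cvg_cst | apply: cvgZr_tmp].
Qed.

Lemma derive_lt0_near (R : realType) (f : R -> R) (d : R) :
  is_derive (0 : R) 1 f d -> d < 0 -> \forall t \near 0^'+, f t < f 0.
Proof.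
move=> [df <-] d0.
have h := cvgr_lt _ (cvg_dnbhs_at_right df) _ d0.
near=> t; have t0 : 0 < t by near: t; exact: nbhs_right_gt.
have : t^-1 *: ((f \o shift 0) (t *: 1) - f 0) < 0 by near: t; exact: h.
rewrite /= addr0 [t%:A]mulr1 /GRing.scale /= pmulr_rlt0 ?invr_gt0 //.
by rewrite subr_lt0.
Unshelve. all: by end_near.
Qed.

Lemma derive_coordE (R : realType) (F : R * R -> R) (p V : R * R) :
  differentiable F p -> 'D_V F p = dot ('D_(1, 0) F p, 'D_(0, 1) F p) V.
Proof.
move=> dF; rewrite !deriveE // /dot /=.
rewrite [X in 'd F p X](_ : V = V.1 *: (1, 0) + V.2 *: (0, 1)).
  by rewrite linearD !linearZ /= [_ * V.1]mulrC [_ * V.2]mulrC.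
case: V => x y; rewrite !scale_pairE /= !mulr1 !mulr0.
by congr (_, _); rewrite /= ?addr0 ?add0r.
Qed.

Lemma cvg_coord (R : realType) (T : Type) (F : set_system T) (f : T -> R * R)
    (p : R * R) : Filter F -> f x @[x --> F] --> p ->
  (f x).1 @[x --> F] --> p.1 /\ (f x).2 @[x --> F] --> p.2.
Proof.
case: p => x y FF h; split; first by apply: (cvg_comp _ _ h); exact: cvg_fst.
by apply: (cvg_comp _ _ h); exact: cvg_snd.
Qed.

Lemma cvg_dot (R : realType) (T : Type) (F : set_system T) (f g : T -> R * R)
    (p q : R * R) : Filter F -> f x @[x --> F] --> p -> g x @[x --> F] --> q ->
  dot (f x) (g x) @[x --> F] --> dot p q.
Proof.
move=> FF /cvg_coord[f1 f2] /cvg_coord[g1 g2].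
exact: cvgD (cvgM f1 g1) (cvgM f2 g2).
Qed.

(** * Linear forms of the hyperboloid model *)

(** In the hyperboloid model of the plane in R^(2,1) these functions are the
    restrictions of the linear forms; b ^+ 2 - 4 * a * c is the Minkowski norm
    of (a, b, c).  The exponentials of Busemann functions are null forms, and
    the level sets of the spacelike ones are the curves at constant distance
    from a geodesic. *)
Definition linform (R : realType) (a b c : R) (p : R * R) : R :=
  (a * (p.1 ^+ 2 + p.2 ^+ 2) + b * p.1 + c) / p.2.

(** This is p.2 times the Euclidean gradient of the linear form; with this
    normalization its squared length is the Minkowski norm of (a, b, c) plus the
    square of the value at p. *)
Definition lingrad (R : realType) (a b c : R) (p : R * R) : R * R :=
  (2 * a * p.1 + b, 2 * a * p.2 - linform a b c p).

Lemma linformZ (R : realType) (k a b c : R) (p : R * R) :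
  linform (k * a) (k * b) (k * c) p = k * linform a b c p.
Proof. by rewrite /linform mulrA; congr (_ / _); ring. Qed.

Lemma lingradZ (R : realType) (k a b c : R) (p : R * R) :
  lingrad (k * a) (k * b) (k * c) p = k *: lingrad a b c p.
Proof.
by rewrite /lingrad linformZ scale_pairE; congr (_, _); ring.
Qed.

(** After multiplication by the ordinate a linear form becomes quadratic with
    leading part a |z|^2, so its Taylor expansion at p is exact. *)
Lemma linform_expansion (R : realType) (a b c : R) (p z : R * R) :
  halfplane p -> halfplane z ->
  z.2 * (linform a b c z - linform a b c p) =
  dot (lingrad a b c p) (z - p) + a * dot (z - p) (z - p).
Proof.
case: p z => [p1 p2] [z1 z2]; rewrite /halfplane /= => Hp Hz.
have p0 : p2 != 0 by rewrite gt_eqF.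
have z0 : z2 != 0 by rewrite gt_eqF.
rewrite /lingrad /linform /dot /=.
by field; rewrite p0 z0.
Qed.

Lemma dot_lingrad (R : realType) (a b c : R) (p : R * R) : halfplane p ->
  dot (lingrad a b c p) (lingrad a b c p) =
  b ^+ 2 - 4 * a * c + linform a b c p ^+ 2.
Proof.
move=> Hp; rewrite /halfplane /= in Hp.
have p0 : p.2 != 0 by rewrite gt_eqF.
rewrite /lingrad /linform /dot /=.
by field.
Qed.

(** A horocycle curves more than a curve equidistant from a geodesic.  When the
    two are tangent at p, h = linform A (- 2 * B) C and l f have the same
    gradient there, and by the exact expansion h - l f differs from its value at
    p by (A - l * a) |z - p|^2 / z.2.  The squared lengths of the gradients give
    h(p)^2 = l^2 (I + f(p)^2) > (l f(p))^2, and their second coordinates give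
    2 (A - l * a) p.2 = h(p) - l f(p), so A - l * a > 0.  On the horoball
    h <= h(p), the function l f therefore has a strict maximum at p. *)
Lemma tangent_horocycle_extremum (R : realType) (a b c A B C l : R) (p z : R * R) :
  0 < b ^+ 2 - 4 * a * c -> B ^+ 2 = A * C ->
  halfplane p -> halfplane z -> z != p -> 0 < linform A (- 2 * B) C p ->
  linform A (- 2 * B) C z <= linform A (- 2 * B) C p ->
  lingrad A (- 2 * B) C p = l *: lingrad a b c p ->
  l * (linform a b c z - linform a b c p) < 0.
Proof.
move=> I0 BAC Hp Hz zp; have := dot_lingrad A (- 2 * B) C Hp.
have Gf := dot_lingrad a b c Hp.
have := linform_expansion a b c Hp Hz.
have := linform_expansion A (- 2 * B) C Hp Hz.
set Fz := linform A _ _ z; set F := linform A _ _ p.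
set fz := linform a _ _ z; set f := linform a b c p in Gf *.
move=> EF Ef GF F0 Fle Gl.
have p2 : 0 < p.2 := Hp; have z2 : 0 < z.2 := Hz.
have l2 : F ^+ 2 = l ^+ 2 * (b ^+ 2 - 4 * a * c + f ^+ 2).
  rewrite -Gf.
  transitivity (dot (lingrad A (- 2 * B) C p) (lingrad A (- 2 * B) C p)).
    by rewrite GF -mulrA -BAC; ring.
  by rewrite Gl /lingrad scale_pairE /dot /=; ring.
have l0 : l != 0.
  apply: contraL F0 => /eqP l0; move/eqP: l2.
  by rewrite l0 expr0n /= mul0r expf_eq0 /= => /eqP ->; rewrite ltxx.
have lf : l * f < F.
  rewrite ltNge; apply/negP => lF.
  have : F ^+ 2 <= (l * f) ^+ 2.
    by rewrite ler_pXn2r ?nnegrE ?(ltW F0) ?(le_trans (ltW F0)).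
  have l20 : 0 < l ^+ 2 by rewrite exprn_even_gt0.
  rewrite l2 mulrDr [(l * f) ^+ 2]exprMn; have := mulr_gt0 l20 I0; lra.
have k0 : 0 < A - l * a.
  have := congr1 snd Gl; rewrite /lingrad scale_pairE /= -/F -/f => e.
  have : 0 < (A - l * a) * (2 * p.2) by nra.
  by rewrite pmulr_lgt0 // mulr_gt0.
have dzp : 0 < dot (z - p) (z - p) by apply: dot_gt0; rewrite subr_eq0.
rewrite -(pmulr_rlt0 _ z2).
have -> : z.2 * (l * (fz - f)) =
    z.2 * (Fz - F) - (A - l * a) * dot (z - p) (z - p).
  rewrite EF mulrCA Ef Gl /lingrad scale_pairE /dot /=; ring.
have : z.2 * (Fz - F) <= 0 by rewrite pmulr_rle0 // subr_le0.
have := mulr_gt0 k0 dzp.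
lra.
Qed.

Lemma lingrad_neq0 (R : realType) (a b c : R) (p : R * R) : halfplane p ->
  0 < b ^+ 2 - 4 * a * c -> lingrad a b c p != 0.
Proof.
move=> Hp I0; apply/eqP => g0; have := dot_lingrad a b c Hp.
rewrite g0 /dot /= !mulr0 addr0 => /eqP; rewrite lt_eqF //.
by rewrite ltr_wpDr ?sqr_ge0.
Qed.

Lemma cvg_linform (R : realType) (T : Type) (F : set_system T)
    (fa fb fc : T -> R) (fp : T -> R * R) (a b c : R) (p : R * R) : Filter F ->
  fa x @[x --> F] --> a -> fb x @[x --> F] --> b -> fc x @[x --> F] --> c ->
  fp x @[x --> F] --> p -> p.2 != 0 ->
  linform (fa x) (fb x) (fc x) (fp x) @[x --> F] --> linform a b c p.
Proof.
move=> FF ha hb hc /cvg_coord[h1 h2] p0; apply: cvgM; last exact: cvgV.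
apply: cvgD hc; apply: cvgD; last exact: cvgM.
apply: cvgM => //; rewrite expr2 [p.2 ^+ 2]expr2.
by apply: cvgD; apply: cvgM.
Qed.

Lemma linform_first_order (R : realType) (a b c : R) (p V : R * R) :
  halfplane p ->
  (\forall t \near 0^'+, halfplane (p + t *: V) /\
    linform a b c (p + t *: V) <= linform a b c p) ->
  dot (lingrad a b c p) V <= 0.
Proof.
move=> Hp near_le; rewrite leNgt; apply/negP => gV.
have c0 : dot (lingrad a b c p) V + a * (t * dot V V) @[t --> 0^'+] -->
    dot (lingrad a b c p) V + a * (0 * dot V V).
  apply: cvgD; first exact: cvg_cst.
  apply: cvgM; first exact: cvg_cst.
  by apply: cvgM; [exact: cvg_at_right_filter | exact: cvg_cst].
rewrite mul0r mulr0 addr0 in c0.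
have pos := cvgr_gt _ c0 _ gV.
have [t [[t0 [Ht le_t]] gt0]] :=
  filter_ex (filterI (filterI (nbhs_right_gt 0) near_le) (pos _)).
have := linform_expansion a b c Hp Ht.
have -> : p + t *: V - p = t *: V by rewrite addrC addKr.
have -> : dot (lingrad a b c p) (t *: V) + a * dot (t *: V) (t *: V) =
    t * (dot (lingrad a b c p) V + a * (t * dot V V)).
  case: V {c0 pos gV gt0 near_le Ht le_t} => x y.
  by rewrite scale_pairE /dot /=; ring.
have : 0 < t * (dot (lingrad a b c p) V + a * (t * dot V V)) by rewrite mulr_gt0.
move=> + h; rewrite -h pmulr_rgt0 ?subr_gt0 // ltNge le_t //.
Qed.

(** * Killing fields *)

(** In the complex coordinate z these are the fields a z^2 + b z + c of the Lie
    algebra of PSL_2(R), and the invariant is the discriminant.  The components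
    of nabla_X K = omega J X along the two axes are first-order equations for K,
    which are integrated along vertical and horizontal lines. *)
Lemma killing_field_quadratic (R : realType) (K : R * R -> R * R)
    (omega : R * R -> R) : killing K -> rotation_function K omega ->
  exists a b c : R, forall p, halfplane p ->
    K p = (a * (p.1 ^+ 2 - p.2 ^+ 2) + b * p.1 + c, p.2 * (2 * a * p.1 + b)) /\
    killing_invariant K omega p = b ^+ 2 - 4 * a * c.
Proof.
move=> [sK1 sK2 _] Kw.
have [dK1 _ _] := sK1 1%N; have [dK2 _ _] := sK2 1%N.
pose k1 x y := (K (x, y)).1; pose k2 x y := (K (x, y)).2.
pose w x y := omega (x, y).
(* w2 is the common value of d k2 / dx and - d k1 / dy *)
pose w2 x y := w x y - k1 x y / y.
have coordx (x y : R) : (x, y) = (0, y) + x *: (1, 0).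
  by rewrite scale_pairE mulr1 mulr0; congr (_, _); rewrite /= ?add0r ?addr0.
have coordy (x y : R) : (x, y) = (x, 0) + y *: (0, 1).
  by rewrite scale_pairE mulr1 mulr0; congr (_, _); rewrite /= ?add0r ?addr0.
have eqs (x y : R) : 0 < y ->
  [/\ is_derive x 1 (k1^~ y) (k2 x y / y), is_derive x 1 (k2^~ y) (w2 x y),
      is_derive y 1 (k1 x) (- w2 x y) & is_derive y 1 (k2 x) (k2 x y / y)].
  move=> y0; have Hp : halfplane (x, y) by [].
  have := Kw (x, y) (1, 0) Hp; have := Kw (x, y) (0, 1) Hp.
  rewrite /nabla /Defs.rot !scale_pairE /= !mul0r !mul1r !subr0 !addr0 !add0r.
  rewrite oppr0 !mulr0 !mulr1 mulrN mulr1.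
  move=> [e1 e2] [e3 e4].
  have dl (k : R * R -> R) : differentiable k (x, y) ->
      is_derive x 1 (fun t => k (t, y)) ('D_(1, 0) k (x, y)) /\
      is_derive y 1 (fun t => k (x, t)) ('D_(0, 1) k (x, y)).
    move=> dk; split.
      have -> : (fun t => k (t, y)) = (fun t => k ((0, y) + t *: (1, 0))).
        by apply/funext => t; rewrite -coordx.
      by rewrite (coordx x y); apply: is_derive_line; rewrite -coordx.
    have -> : (fun t => k (x, t)) = (fun t => k ((x, 0) + t *: (0, 1))).
      by apply/funext => t; rewrite -coordy.
    by rewrite (coordy x y); apply: is_derive_line; rewrite -coordy.
  have [d1x d1y] := dl _ (dK1 _ Hp); have [d2x d2y] := dl _ (dK2 _ Hp).
  split.
  - by apply: (is_derive_eq d1x); apply/eqP; rewrite -subr_eq0 e3.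
  - by apply: (is_derive_eq d2x); rewrite /w2 /w /k1 -e4 addrK.
  - apply: (is_derive_eq d1y); rewrite /w2 /w /k1 opprB.
    by rewrite addrC; apply/eqP; rewrite -subr_eq e1.
  - by apply: (is_derive_eq d2y); apply/eqP; rewrite -subr_eq0 -mulNr e2.
have cst_pos (f : R -> R) : (forall y : R, 0 < y -> is_derive y 1 f 0) ->
    forall y : R, 0 < y -> f y = f 1.
  move=> df y y0; have [y1|y1] := leP y 1.
    by apply: derive0_eq => // x /andP[yx _]; apply: df; rewrite (lt_le_trans y0).
  apply/esym/derive0_eq => [|x /andP[yx _]]; first exact: ltW.
  by apply: df; rewrite (lt_le_trans _ yx).
have cst_line (f : R -> R) : (forall x : R, is_derive x 1 f 0) ->
    forall x : R, f x = f 0.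
  by move=> df x; exact: is_derive_0_is_cst.
have k2E (x y : R) : 0 < y -> k2 x y = y * k2 x 1.
  move=> y0; suff : k2 x y * y^-1 = k2 x 1 * 1^-1.
    by rewrite invr1 mulr1 => <-; rewrite mulrC divfK // gt_eqF.
  apply: (cst_pos (fun t => k2 x t * t^-1)) y0 => t t0.
  have [_ _ _ d] := eqs x t t0; have t1 : t != 0 by rewrite gt_eqF.
  have dV := is_deriveV t1 (is_derive_id t 1).
  have := is_deriveM d dV => dM.
  apply: (is_derive_eq dM).
  rewrite /GRing.scale /=; field; exact: t1.
have k1E (x y : R) : 0 < y -> k1 x y - k1 x 1 = k1 0 y - k1 0 1.
  move=> y0; apply: (cst_line (fun t => k1 t y - k1 t 1)) => t.
  have [d _ _ _] := eqs t y y0; have [d' _ _ _] := eqs t 1 ltr01.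
  apply: (is_derive_eq (is_deriveB d d')).
  by rewrite k2E // mulrC mulKf ?gt_eqF // divr1 subrr.
have w2E (x y : R) : 0 < y -> w2 x y = y * w2 x 1.
  move=> y0; have [_ d _ _] := eqs x y y0; have [_ d' _ _] := eqs x 1 ltr01.
  rewrite -(derive_val (is_derive := d)).
  have -> : k2^~ y = y \*: k2^~ 1 by apply/funext => t /=; rewrite k2E.
  by rewrite (derive_val (is_derive := is_deriveZ y d')).
(* w2 is linear in y, so the equation for d k1 / dy integrates to a quadratic *)
have k1y (x y : R) : 0 < y -> k1 x y = k1 x 1 - w2 x 1 / 2 * (y ^+ 2 - 1).
  move=> y0; have : k1 x y + w2 x 1 / 2 * (y * y) = k1 x 1 + w2 x 1 / 2 * (1 * 1).
    apply: (cst_pos (fun t => k1 x t + w2 x 1 / 2 * (t * t))) y0 => t t0.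
    have [_ _ d _] := eqs x t t0.
    have di := is_derive_id t (1 : R).
    apply: (is_derive_eq
      (is_deriveD d (is_deriveZ (w2 x 1 / 2) (is_deriveM di di)))).
    by rewrite w2E // /GRing.scale /=; field.
  move/eqP; rewrite -subr_eq0 => /eqP e; apply/eqP.
  by rewrite -subr_eq0 -[X in _ == X]e; apply/eqP; ring.
(* k1 x y - k1 x 1 does not depend on x, which any ordinate other than 1 turns
   into the constancy of w2 on the line of ordinate 1 *)
have w21 x : w2 x 1 = w2 0 1.
  have /(k1E x) : 0 < 2 :> R by [].
  rewrite !(k1y _ 2) //; lra.
set a := w2 0 1 / 2.
have g1 x : k2 x 1 = 2 * a * x + k2 0 1.
  have : k2 x 1 - 2 * a * x = k2 0 1 - 2 * a * 0.
    apply: (cst_line (fun t => k2 t 1 - 2 * a * t)) => t.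
    have [_ d _ _] := eqs t 1 ltr01; have di := is_derive_id t (1 : R).
    apply: (is_derive_eq (is_deriveB d (is_deriveZ (2 * a) di))).
    by rewrite w21 /GRing.scale /= /a; field.
  by move=> e; rewrite -[LHS](subrK (2 * a * x)) e mulr0 subr0 addrC.
have k11 x : k1 x 1 = a * x ^+ 2 + k2 0 1 * x + k1 0 1.
  have : k1 x 1 - (a * (x * x) + k2 0 1 * x) =
      k1 0 1 - (a * (0 * 0) + k2 0 1 * 0).
    apply: (cst_line (fun t => k1 t 1 - (a * (t * t) + k2 0 1 * t))) => t.
    have [d _ _ _] := eqs t 1 ltr01; have di := is_derive_id t (1 : R).
    apply: (is_derive_eq (is_deriveB d (is_deriveD
      (is_deriveZ a (is_deriveM di di)) (is_deriveZ (k2 0 1) di)))).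
    by rewrite g1 /GRing.scale /=; field.
  move=> e; rewrite -[LHS](subrK (a * (x * x) + k2 0 1 * x)) e.
  by rewrite !mulr0 addr0 subr0 addrC -expr2.
exists a, (k2 0 1), (k1 0 1 + a) => -[x y] y0 /=; rewrite /halfplane /= in y0.
have y1 : y != 0 by rewrite gt_eqF.
have K1 : (K (x, y)).1 = a * (x ^+ 2 - y ^+ 2) + k2 0 1 * x + (k1 0 1 + a).
  rewrite -[LHS]/(k1 x y) k1y // k11 w21 -/a; ring.
have K2 : (K (x, y)).2 = y * (2 * a * x + k2 0 1).
  by rewrite -[LHS]/(k2 x y) k2E // g1.
split; first by rewrite -K1 -K2; case: (K (x, y)).
have wE : omega (x, y) = 2 * a * y + (K (x, y)).1 / y.
  apply/eqP; rewrite -subr_eq; apply/eqP.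
  by rewrite -[LHS]/(w2 x y) w2E // w21 /a; field.
rewrite /killing_invariant /metric wE K1 K2 /=; field.
exact: y1.
Qed.

(** * Busemann functions and horoballs *)

Lemma cosh_hdist (R : realType) (p q : R * R) : halfplane p -> halfplane q ->
  0 <= hdist p q /\ expR (hdist p q) + expR (- hdist p q) =
    ((p.1 - q.1) ^+ 2 + p.2 ^+ 2 + q.2 ^+ 2) / (p.2 * q.2).
Proof.
case: p q => [p1 p2] [q1 q2]; rewrite /halfplane /= => p0 q0.
rewrite /hdist /arcosh /=; set u := 1 + _.
have pn : p2 != 0 by rewrite gt_eqF.
have qn : q2 != 0 by rewrite gt_eqF.
have u1 : 1 <= u.
  by rewrite lerDl divr_ge0 ?addr_ge0 ?sqr_ge0 // !mulr_ge0 // ltW.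
have s2 : 0 <= u ^+ 2 - 1 by rewrite subr_ge0 exprn_ege1.
set s := Num.sqrt _; have s0 : 0 <= s by exact: sqrtr_ge0.
have sE : s ^+ 2 = u ^+ 2 - 1 by rewrite sqr_sqrtr.
have us0 : 0 < u + s by rewrite ltr_wpDr // (lt_le_trans ltr01).
split; first by rewrite ln_ge0 // ler_wpDr.
rewrite expRN lnK ?posrE // -[RHS]divr1.
have -> : (u + s)^-1 = u - s.
  apply: (mulfI (lt0r_neq0 us0)); rewrite divff ?gt_eqF //.
  by rewrite mulrC -subr_sqr sE; ring.
by rewrite /u; field; rewrite pn qn.
Qed.

(** As hdist p (g t) - t converges to b p, the limit of expR (- t) times twice
    cosh (hdist p (g t)) is expR (b p).  By the formula for cosh this quantity
    is linform (A t) (- 2 * B t) (C t) p, with coefficients depending on t only.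
    They converge because their combinations at three points do, and
    B^2 - A C = - expR (- 2 t) tends to 0, so the limit form is null. *)
Lemma busemann_linform (R : realType) (b : R * R -> R) : busemann b ->
  exists A B C : R, [/\ 0 <= A, 0 <= C, B ^+ 2 = A * C &
    forall p, halfplane p -> expR (b p) = linform A (- 2 * B) C p].
Proof.
move=> [g [gH _] gb].
pose x t := (g t).1; pose y t := (g t).2; pose e t : R := expR (- t).
have transfer (f h : R -> R) (l l' : R) : f t @[t --> +oo] --> l ->
    (forall t, 0 <= t -> f t = h t) -> l = l' -> h t @[t --> +oo] --> l'.
  move=> + fh <-; apply: cvg_trans; apply: near_eq_cvg; near=> t; apply: fh.
  by near: t; exact: nbhs_pinfty_ge.
have e0 : e t @[t --> +oo] --> 0 by exact: cvgr_expR.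
have y0 t : 0 <= t -> y t != 0.
  by move=> /gH; rewrite /halfplane /= => /lt0r_neq0.
have lim p : halfplane p ->
    e t / y t * ((p.1 - x t) ^+ 2 + p.2 ^+ 2 + y t ^+ 2) @[t --> +oo] -->
    p.2 * expR (b p).
  move=> Hp; have p2 : p.2 != 0 by rewrite gt_eqF.
  have l1 : expR (hdist p (g t) - t) @[t --> +oo] --> expR (b p).
    exact: (cvg_comp _ _ (gb p Hp) (@continuous_expR R _)).
  have l2 : e t * expR (- hdist p (g t)) @[t --> +oo] --> 0.
    apply: (@squeeze_cvgr _ _ _ _ (fun=> 0) e) => //; last exact: cvg_cst.
    near=> t; have /gH Hg : 0 <= t by near: t; exact: nbhs_pinfty_ge.
    have [d0 _] := cosh_hdist Hp Hg.
    rewrite mulr_ge0 ?expR_ge0 //= ger_pMr ?expR_gt0 // -[leRHS]expR0 ler_expR.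
    by rewrite oppr_le0.
  apply: (transfer _ _ _ _ (cvgM (cvg_cst p.2) (cvgD l1 l2))) => [t t0 /=|];
    last by rewrite addr0.
  have [_ h] := cosh_hdist Hp (gH t t0).
  rewrite !fctE expRD -/(e t) [_ * e t]mulrC -mulrDr h.
  rewrite -/(x t) -/(y t); field.
  by apply/andP; split; [exact: y0 t t0|exact: p2].
pose A t := e t / y t; pose B t := A t * x t.
pose C t := A t * (x t ^+ 2 + y t ^+ 2).
have Hi : halfplane ((0, 1) : R * R) by rewrite /halfplane /=.
have H2i : halfplane ((0, 2) : R * R) by rewrite /halfplane /=.
have H1i : halfplane ((1, 1) : R * R) by rewrite /halfplane /=.
have := lim _ Hi; have := lim _ H2i; have := lim _ H1i => /=.
set l11 := 1 * _; set l02 := 2 * _; set l01 := 1 * _ => c11 c02 c01.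
have cA : exists a : R, A t @[t --> +oo] --> a.
  exists (3^-1 * (l02 - l01)).
  apply: (transfer _ _ _ _ (cvgM (cvg_cst (3^-1 : R)) (cvgB c02 c01))) =>
    // t t0 /=.
  by rewrite !fctE /= /A; move: (e t) (x t) (y t) (y0 t t0) => z u v v0; field.
have [a {}cA] := cA.
have cC : exists c : R, C t @[t --> +oo] --> c.
  exists (l01 - a).
  apply: (transfer _ _ _ _ (cvgB c01 cA)) => // t t0 /=; rewrite ?fctE /C /A.
  by move: (e t) (x t) (y t) (y0 t t0) => z u v v0; field.
have [c {}cC] := cC.
have cB : exists d : R, B t @[t --> +oo] --> d.
  exists (2^-1 * (l01 + a - l11)).
  apply: (transfer _ _ _ _ (cvgM (cvg_cst (2^-1 : R))
    (cvgB (cvgD c01 cA) c11))) => // t t0 /=.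
  rewrite !fctE /= /B /A.
  by move: (e t) (x t) (y t) (y0 t t0) => z u v v0; field.
have [d {}cB] := cB.
have bE p : halfplane p -> expR (b p) = linform a (- 2 * d) c p.
  move=> Hp; have p2 : p.2 != 0 by rewrite gt_eqF.
  have h : e t / y t * ((p.1 - x t) ^+ 2 + p.2 ^+ 2 + y t ^+ 2) @[t --> +oo] -->
      (p.1 ^+ 2 + p.2 ^+ 2) * a + (- 2 * p.1) * d + c.
    apply: (transfer _ _ _ _ (cvgD (cvgD
      (cvgM (cvg_cst (p.1 ^+ 2 + p.2 ^+ 2)) cA)
      (cvgM (cvg_cst (- 2 * p.1)) cB)) cC)) => // t t0 /=.
    rewrite !fctE /= /B /C /A.
    by move: (e t) (x t) (y t) (y0 t t0) => z u v v0; field.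
  have := cvg_unique (@Rhausdorff R) (lim p Hp) h.
  move=> E; apply: (mulfI p2); rewrite E /linform; field; exact: p2.
have dac : d ^+ 2 = a * c.
  apply/eqP; rewrite -subr_eq0; apply/eqP.
  apply: (cvg_unique (@Rhausdorff R) (cvgB (cvgM cB cB) (cvgM cA cC))).
  apply: (transfer _ _ _ _ (cvgN (cvgM e0 e0))) => [t t0 /=|];
    last by rewrite mulr0 oppr0.
  rewrite !fctE /= /B /C /A; move: (e t) (x t) (y t) (y0 t t0) => z u v v0.
  by field; exact: v0.
have ac0 : 0 < a + c.
  have := bE _ Hi; rewrite /linform /= => E; have := expR_gt0 (b (0, 1)).
  rewrite E; lra.
have ac : 0 <= a * c by rewrite -dac sqr_ge0.
by exists a, d, c; split => //; nra.
Unshelve. all: by end_near.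
Qed.

(** Null linear forms, parametrized by vectors: a nonzero w stands for the ideal
    point w.2 / w.1, and normalizing w to the unit circle makes the family of
    horoballs compact. *)
Definition horolevel (R : realType) (w : R * R) : R * R -> R :=
  linform (w.1 ^+ 2) (- 2 * (w.1 * w.2)) (w.2 ^+ 2).

Lemma horolevel_gt0 (R : realType) (w p : R * R) :
  dot w w = 1 -> halfplane p -> 0 < horolevel w p.
Proof.
case: w p => u v [x y]; rewrite /halfplane /horolevel /linform /dot /= => w1 y0.
apply: divr_gt0 => //.
have -> : u ^+ 2 * (x ^+ 2 + y ^+ 2) + - 2 * (u * v) * x + v ^+ 2 =
  (u * x - v) ^+ 2 + (u * y) ^+ 2 by ring.
have [u0|u0] := eqVneq u 0.
  rewrite u0 !mul0r sub0r sqrrN expr0n addr0.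
  by move: w1; rewrite u0 mul0r add0r -expr2 => ->.
by rewrite ltr_wpDl ?sqr_ge0 // exprn_even_gt0 //= mulf_neq0 // gt_eqF.
Qed.

Lemma horoball_horolevel (R : realType) (B : set (R * R)) : horoball B ->
  exists (w : R * R) (d : R), dot w w = 1 /\
    B = [set q | halfplane q /\ horolevel w q <= d].
Proof.
move=> [b /busemann_linform[A [B0 [C [A0 C0 BAC bE]]]] [c ->]].
have Hi : halfplane ((0, 1) : R * R) by rewrite /halfplane /=.
have AC0 : 0 < A + C.
  have := expR_gt0 (b (0, 1)); rewrite (bE _ Hi) /linform /=; lra.
pose s := (A + C)^-1; have s0 : 0 < s by rewrite invr_gt0.
pose u := Num.sqrt (s * A).
(* the sign of B0 is that of the ideal point w.2 / w.1 *)
pose v := (if 0 <= B0 then 1 else -1) * Num.sqrt (s * C).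
have u2 : u ^+ 2 = s * A by rewrite sqr_sqrtr // mulr_ge0 // ltW.
have v2 : v ^+ 2 = s * C.
  rewrite exprMn sqr_sqrtr ?mulr_ge0 // ?(ltW s0) //.
  by case: ifP => _; rewrite ?sqrrN expr1n mul1r.
have uv : u * v = s * B0.
  rewrite /u /v mulrCA -sqrtrM ?mulr_ge0 ?(ltW s0) // mulrACA -BAC -expr2 -exprMn.
  rewrite sqrtr_sqr normrM (gtr0_norm s0).
  case: ifP => [Bp|/negbT]; first by rewrite mul1r ger0_norm.
  by rewrite -ltNge => Bn; rewrite ltr0_norm // mulN1r mulrN opprK.
exists (u, v), (s * expR c); split.
  rewrite /dot /= -!expr2 u2 v2 -mulrDr /s mulVf //; exact: lt0r_neq0.
apply/seteqP; split=> q /= [Hq].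
  rewrite -ler_expR (bE _ Hq) => h; split=> //.
  by rewrite /horolevel /= u2 v2 uv mulrCA linformZ ler_pM2l.
rewrite /horolevel /= u2 v2 uv mulrCA linformZ ler_pM2l // -(bE _ Hq) ler_expR.
by split.
Qed.

Lemma compact_circle (R : realType) : compact [set w : R * R | dot w w = 1].
Proof.
have cB : compact (`[-1, 1] `*` `[-1, 1] : set (R * R)).
  by apply: compact_setX; exact: segment_compact.
apply: subclosed_compact cB _.
  apply: (@preimage_closed _ _ (fun w : R * R => dot w w) [set x | x = 1]).
    by move=> w _; apply: cvg_dot; exact: cvg_id.
  exact: closed_eq.
move=> [x y]; rewrite /dot /= => h.
have x2 := sqr_ge0 x; have y2 := sqr_ge0 y; rewrite -!expr2 in h.
by split => /=; rewrite in_itv /= -ler_norml -(ler_pXn2r (ltn0Sn 1)) ?nnegrE //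
  real_normK ?num_real // expr1n; lra.
Qed.

(** Suppose that for every ideal point the horoball whose horocycle passes
    through p misses some q of the closure.  The same q is missed by the
    horoballs at nearby ideal points whose horocycles pass through points p'
    near p.  The ideal points form a compact circle, so one neighbourhood of p
    serves all of them: a point p' there lies in every horoball that contains
    the closure.  As p' can be chosen outside the closure, this contradicts
    horoconvexity. *)
Lemma supporting_horoball (R : realType) (Omega : set (R * R)) (p : R * R) :
  horoconvex Omega -> closure Omega `<=` @halfplane R -> halfplane p ->
  closure (~` closure Omega) p ->
  exists2 w : R * R, dot w w = 1 &
    forall q, closure Omega q -> horolevel w q <= horolevel w p.
Proof.
move=> [G Ghoro GO] OH Hp cp; apply: contrapT => none.
have p2 : p.2 != 0 by rewrite gt_eqF.
have cov := (compact_near_coveringP _).1 (@compact_circle R).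
have nHp : nbhs p (@halfplane R).
  have [_ h] := cvg_coord _ (@cvg_id _ (nbhs p)); exact: cvgr_gt h _ Hp.
have [|p' []] := cp (@halfplane R `&`
    [set p' | [set w : R * R | dot w w = 1] `<=`
      [set w | exists2 q, closure Omega q & horolevel w p' < horolevel w q]]).
  apply: filterI nHp _; apply: (cov _ (nbhs p) (fun p' w =>
    exists2 q, closure Omega q & horolevel w p' < horolevel w q)) => w w1.
  have [q Oq pq] : exists2 q, closure Omega q & horolevel w p < horolevel w q.
    apply: contrapT => nq; apply: none; exists w => // q Oq; rewrite leNgt.
    by apply/negP => pq; apply: nq; exists q.
  have q2 : q.2 != 0 by rewrite gt_eqF // OH.
  have FF : Filter (filter_prod (nbhs w) (nbhs p)) by exact: filter_prod_filter.
  have c1 : z.1 @[z --> filter_prod (nbhs w) (nbhs p)] --> w by exact: cvg_fst.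
  have c2 : z.2 @[z --> filter_prod (nbhs w) (nbhs p)] --> p by exact: cvg_snd.
  have hl (f : (R * R) * (R * R) -> R * R) (q' : R * R) : q'.2 != 0 ->
      f z @[z --> filter_prod (nbhs w) (nbhs p)] --> q' ->
      horolevel z.1 (f z) @[z --> filter_prod (nbhs w) (nbhs p)] -->
        horolevel w q'.
    move=> q'2 fq'; have [w1c w2c] := cvg_coord _ c1.
    apply: cvg_linform => //; rewrite ?expr2; apply: cvgM => //.
      exact: cvg_cst.
    exact: cvgM.
  have hd := cvgB (hl (fun=> q) q q2 (cvg_cst q)) (hl snd p p2 c2).
  rewrite -subr_gt0 in pq; have nz := cvgr_gt _ (hd FF FF) _ pq.
  apply: (@filterS _ _ FF _ _ _ (nz FF)) => z /= h.
  by exists q => //; rewrite -subr_gt0.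
move=> np' [Hp' hp']; apply: np'; rewrite GO => B GB.
have [w [d [w1 BE]]] := horoball_horolevel (Ghoro B GB).
have [q Oq pq] := hp' w w1.
have : B q by move: Oq; rewrite GO; exact.
rewrite BE => -[_ qd]; split => //=.
exact: ltW (lt_le_trans pq qd).
Qed.

(** * Boundary of a bounded smooth domain *)

(** A bound on cosh of the distance to a fixed point confines the domain to a
    Euclidean rectangle that stays away from the line at infinity. *)
Lemma compact_closure_hbounded (R : realType) (Omega : set (R * R)) :
  Omega `<=` @halfplane R ->
  (exists r : R, forall p q, Omega p -> Omega q -> hdist p q <= r) ->
  compact (closure Omega) /\ closure Omega `<=` @halfplane R.
Proof.
move=> OH [r Or].
have [->|/set0P[p0 Op0]] := eqVneq Omega set0.
  by rewrite closure0; split; [exact: compact0 | exact: sub0set].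
have p0H := OH _ Op0; pose E := expR r; pose y0 := p0.2; pose x0 := p0.1.
have y00 : 0 < y0 := p0H.
have E0 : 0 < E by exact: expR_gt0.
pose m := y0 / (2 * E); pose M := 2 * y0 * E.
have OB : Omega `<=` `[x0 - 2 * y0 * E, x0 + 2 * y0 * E] `*` `[m, M].
  move=> [x y] Oxy; have y_gt0 : 0 < y := OH _ Oxy.
  have [d0 h] := cosh_hdist p0H (OH _ Oxy).
  have hE : expR (hdist p0 (x, y)) <= E by rewrite ler_expR Or.
  have hE1 : expR (- hdist p0 (x, y)) <= E.
    by rewrite (le_trans _ hE) // ler_expR (le_trans _ d0) // oppr_le0.
  have : (x0 - x) ^+ 2 + y0 ^+ 2 + y ^+ 2 <= 2 * E * (y0 * y).
    rewrite -ler_pdivrMr ?mulr_gt0 // -[leLHS]h.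
    by rewrite (le_trans (lerD hE hE1)) // mulrC mulr_natr mulr2n.
  move=> H; have x2 := sqr_ge0 (x0 - x).
  have yM : y <= M.
    rewrite -(ler_pM2r y_gt0) /M; nra.
  have ym : m <= y.
    rewrite /m ler_pdivrMr ?mulr_gt0 // -(ler_pM2r y00); nra.
  have xM : (x0 - x) ^+ 2 <= (2 * y0 * E) ^+ 2.
    have : (2 * E * y0) * y <= (2 * E * y0) * M by rewrite ler_pM2l ?mulr_gt0.
    rewrite /M; have := sqr_ge0 y; have := sqr_ge0 y0; nra.
  split => /=; rewrite in_itv /=; last by rewrite ym.
  have M0 : 0 <= 2 * y0 * E by rewrite !mulr_ge0 // ltW.
  have : `|x0 - x| <= 2 * y0 * E.
    by rewrite -(ler_pXn2r (ltn0Sn 1)) ?nnegrE // real_normK ?num_real.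
  rewrite ler_norml => /andP[h1 h2].
  by apply/andP; split; lra.
have cB : compact (`[x0 - 2 * y0 * E, x0 + 2 * y0 * E] `*` `[m, M]).
  by apply: compact_setX; exact: segment_compact.
have clB : closed (`[x0 - 2 * y0 * E, x0 + 2 * y0 * E] `*` `[m, M]).
  by apply: compact_closed cB; exact: norm_hausdorff.
have cOB := closureS OB; rewrite -(proj1 (closure_id _) clB) in cOB.
split; first by apply: subclosed_compact cB cOB; exact: closed_closure.
move=> q /cOB[_ /=]; rewrite in_itv /= => /andP[mq _].
by rewrite /halfplane /= (lt_le_trans _ mq) // divr_gt0 ?mulr_gt0.
Qed.

(** The normal is the gradient of a local defining function.  Leaving p along it
    meets points where that function is positive, so p is also a limit of points
    outside the closure; horoconvexity has to be applied at such points. *)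
Lemma boundary_normal (R : realType) (Omega : set (R * R)) (p : R * R) :
  open Omega -> smooth_boundary Omega -> bdry Omega p ->
  exists2 n : R * R, n != 0 &
   (forall V, dot n V < 0 -> \forall t \near 0^'+, Omega (p + t *: V)) /\
   closure (~` closure Omega) p.
Proof.
move=> oO sO Bp; have [U [rho [oU Up srho drho OU]]] := sO p Bp.
have [cOp nOp] := Bp; rewrite (proj1 (interior_id _) oO) in nOp.
have [dif _ _] := srho 1%N; have difp := dif p Up.
have rhop : rho p = 0.
  apply/eqP; rewrite eq_le; apply/andP; split; last first.
    rewrite leNgt; apply/negP => r0; apply: nOp.
    have : (Omega `&` U) p by rewrite OU.
    by case.
  rewrite leNgt; apply/negP => r0.
  have nr := cvgr_gt _ (differentiable_continuous difp) _ r0.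
  have [q [Oq [Uq /= rq]]] := cOp _ (filterI (open_nbhs_nbhs (conj oU Up)) (nr _)).
  have : (Omega `&` U) q by [].
  by rewrite OU => -[_ /ltW]; rewrite leNgt rq.
pose n := ('D_(1, 0) rho p, 'D_(0, 1) rho p).
(* s selects the side: the inner one for s = 1, the outer one for s = - 1 *)
have near_sign V (s : R) : s * dot n V < 0 ->
    \forall t \near 0^'+, s * rho (p + t *: V) < 0 /\ U (p + t *: V).
  move=> nV; near=> t; split; last first.
    by near: t; apply: cvg_line; exact: open_nbhs_nbhs.
  near: t; have dp0 : differentiable rho (p + 0 *: V) by rewrite scale0r addr0.
  have d := is_deriveZ s (is_derive_line dp0).
  have := derive_lt0_near d; rewrite /= scale0r addr0 derive_coordE // rhop.
  by rewrite [s *: 0]mulr0; apply.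
have n0 : n != 0.
  apply/eqP => n0; have [X] := drho p Up.
  by rewrite derive_coordE // -/n n0 /dot /= !mul0r addr0 eqxx.
exists n => //; split=> [V nV|].
  have := near_sign V 1; rewrite mul1r => /(_ nV); apply: filterS => t.
  rewrite mul1r => -[r0 Ut]; have : (Omega `&` U) (p + t *: V) by rewrite OU.
  by case.
move=> W Wp; have nn : -1 * dot n n < 0.
  by rewrite mulN1r oppr_lt0; exact: dot_gt0.
have Wn : \forall t \near 0^'+, W (p + t *: n) by exact: cvg_line.
have [t [[]]] := filter_ex (filterI (near_sign _ _ nn) Wn).
rewrite mulN1r oppr_lt0; set q := p + _ => rq Uq Wq.
exists q; split=> // cq.
have cr := differentiable_continuous (dif q Uq).
have nq := cvgr_gt _ cr _ rq.
have [z [Oz [Uz /= rz]]] := cq _ (filterI (open_nbhs_nbhs (conj oU Uq)) (nq _)).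
have : (Omega `&` U) z by [].
by rewrite OU => -[_ /ltW]; rewrite leNgt rz.
Unshelve. all: by end_near.
Qed.

(** Along a direction V entering the domain psi starts from 0 and is positive.
    If the boundary gradient pointed against V, continuity of the gradient up to
    the boundary would make psi decreasing along V near p, so psi would stay
    above a positive value while tending to 0. *)
Lemma gradient_inward (R : realType) (Omega : set (R * R)) (psi : R * R -> R)
    (grad : R * R -> R * R) (p V : R * R) :
  C1_closure Omega psi grad ->
  (forall q, Omega q -> 0 < psi q) -> bdry Omega p -> psi p = 0 ->
  (\forall t \near 0^'+, Omega (p + t *: V)) -> 0 <= dot (grad p) V.
Proof.
move=> [cpsi cgrad dpsi] psi0 [cp _] psip nearO.
rewrite leNgt; apply/negP => gV.
have wline : (p + t *: V) @[t --> 0^'+] --> within (closure Omega) (nbhs p).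
  move=> W /= Wp; have := @cvg_line _ p V _ Wp; move: nearO.
  apply: filterS2 => t Ot; apply.
  exact: subset_closure.
have pline : psi (p + t *: V) @[t --> 0^'+] --> 0.
  rewrite -[X in _ --> X]psip.
  exact: (cvg_comp _ _ wline ((subspace_continuousP _ _).1 cpsi p cp)).
have gline : grad (p + t *: V) @[t --> 0^'+] --> grad p.
  exact: (cvg_comp _ _ wline ((subspace_continuousP _ _).1 cgrad p cp)).
have dneg := cvgr_lt _ (cvg_dot _ gline (cvg_cst V)) _ gV.
have [d /= d0 dP] := (nbhs_ballP _ _).1 (filterI nearO (dneg _ _ _)).
have {}dP t : 0 < t < d -> Omega (p + t *: V) /\ dot (grad (p + t *: V)) V < 0.
  by move=> /andP[t0 td]; apply: dP => //; rewrite /ball /= sub0r normrN gtr0_norm.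
pose s := d / 2; have s0 : 0 < s by rewrite divr_gt0.
have sd : s < d by rewrite /s; lra.
have psis : 0 < psi (p + s *: V) by apply: psi0; apply: (dP s _).1; rewrite s0.
have mono t : 0 < t < s -> psi (p + s *: V) <= psi (p + t *: V).
  move=> /andP[t0 ts].
  have df x : x \in `[t, s]%R -> is_derive x 1 (fun t => psi (p + t *: V))
      ('d psi (p + x *: V) V).
    rewrite in_itv /= => /andP[tx xs].
    have [Ox _] : Omega (p + x *: V) /\ dot (grad (p + x *: V)) V < 0.
      by apply: dP; rewrite (lt_le_trans t0 tx) (le_lt_trans xs sd).
    have [dx _] := dpsi _ Ox; rewrite -deriveE //; exact: is_derive_line.
  have dfo x : x \in `]t, s[%R -> is_derive x 1 (fun t => psi (p + t *: V))
      ('d psi (p + x *: V) V).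
    by rewrite in_itv /= => /andP[tx xs]; apply: df; rewrite in_itv /= !ltW.
  have cf : {within `[t, s], continuous (fun t => psi (p + t *: V))}.
    by apply: derivable_within_continuous => x /df [].
  have [x + E] := MVT ts dfo cf; rewrite in_itv /= => /andP[tx xs].
  rewrite -subr_le0 E.
  have [Ox gx] : Omega (p + x *: V) /\ dot (grad (p + x *: V)) V < 0.
    by apply: dP; rewrite (lt_trans t0 tx) (lt_trans xs sd).
  have [_ ->] := dpsi _ Ox; rewrite mulr_le0_ge0 ?subr_ge0 ?(ltW ts) //.
  rewrite /metric -/(dot _ _) mulr_le0_ge0 ?(ltW gx) // invr_ge0 sqr_ge0.
  by [].
have small := cvgr_lt _ pline _ psis.
have [t [[t0 ts] lt_psi]] := filter_ex (filterI (filterI (nbhs_right_gt 0)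
  (nbhs_right_lt s0)) (small _)).
by have := mono t; rewrite t0 ts => /(_ isT); rewrite leNgt lt_psi.
Qed.

(** Lagrange condition: at a boundary point where a linear form is maximal over
    the domain, its gradient is normal to the boundary.  This serves both for
    the supporting horoball and for the function constant along K. *)
Lemma linform_max_normal (R : realType) (Omega : set (R * R)) (a b c : R)
    (p n : R * R) : Omega `<=` @halfplane R -> halfplane p -> n != 0 ->
  (forall V, dot n V < 0 -> \forall t \near 0^'+, Omega (p + t *: V)) ->
  (forall q, Omega q -> linform a b c q <= linform a b c p) ->
  exists l, lingrad a b c p = l *: n.
Proof.
move=> OH Hp n0 inw pmax; apply: halfplane_duality n0 _ => V /inw nearO.
apply: linform_first_order => //; move: nearO; apply: filterS => t Ot.
by split; [exact: OH | exact: pmax].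
Qed.

(** A linear form of a spacelike vector has no critical point, so its maximum over
    the closure cannot be attained inside. *)
Lemma linform_max_bdry (R : realType) (Omega : set (R * R)) (a b c : R)
    (p : R * R) : open Omega -> closure Omega `<=` @halfplane R ->
  0 < b ^+ 2 - 4 * a * c -> closure Omega p ->
  (forall q, Omega q -> linform a b c q <= linform a b c p) -> bdry Omega p.
Proof.
move=> oO OH I0 cp pmax; have Hp := OH _ cp.
split=> //; rewrite (proj1 (interior_id _) oO) => Op.
have : dot (lingrad a b c p) (lingrad a b c p) <= 0.
  apply: linform_first_order => //.
  have nO : \forall t \near 0^'+, Omega (p + t *: lingrad a b c p).
    by apply: cvg_line; exact: open_nbhs_nbhs.
  apply: filterS nO => t Ot.
  by split; [exact/OH/subset_closure | exact: pmax].
by apply/negP; rewrite -ltNge; apply: dot_gt0; exact: lingrad_neq0.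
Qed.

(** * Counting the zeros *)

Lemma card_set2_eq2 (T : Type) (x y : T) : x <> y -> ([set x; y] #= `I_2)%card.
Proof.
move=> xy; apply/eq_cardSP; exists x; first by left.
apply/eq_cardSP; exists y; first by split; [right | move=> /esym].
suff -> : ([set x; y] `\ x) `\ y = set0 by rewrite II0.
by apply/seteqP; split=> // z [[[->|->] zx] zy]; [case: zx | case: zy].
Qed.

Theorem proposition7p2 (R : realType) (Omega : set (R * R))
    (psi : R * R -> R) (grad_psi : R * R -> R * R)
    (K : R * R -> R * R) (omega : R * R -> R)
    (Omega_domain : bounded_smooth_domain Omega)
    (Omega_horoconvex : horoconvex Omega)
    (psi_C1 : C1_closure Omega psi grad_psi)
    (psi_gt0 : forall p, Omega p -> 0 < psi p)
    (psi_bdry : forall p, bdry Omega p -> psi p = 0)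
    (grad_bdry : forall p, bdry Omega p -> grad_psi p != 0)
    (K_killing : killing K)
    (K_neq0 : exists2 p, halfplane p & K p != 0)
    (K_omega : rotation_function K omega)
    (I_K_gt0 : forall p, halfplane p -> 0 < killing_invariant K omega p) :
  ([set p | bdry Omega p /\ derivative_along K grad_psi p = 0] #= `I_2)%card.
Proof.
have [OH oO _ [q0 Oq0] [Obnd Osm]] := Omega_domain.
have [cO cOH] := compact_closure_hbounded OH Obnd.
have subO := @subset_closure _ Omega.
have [a [b [c KE]]] := killing_field_quadratic K_killing K_omega.
have I0 : 0 < b ^+ 2 - 4 * a * c.
  by have Hq := OH _ Oq0; have [_ <-] := KE _ Hq; exact: I_K_gt0.
have K0 p : halfplane p -> K p != 0.
  move=> Hp; apply/eqP => Kp; have := I_K_gt0 _ Hp.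
  rewrite /killing_invariant /metric Kp /= !mulr0 addr0 mul0r sub0r oppr_gt0.
  by rewrite ltNge sqr_ge0.
(* f is constant along the flow of K *)
set f := linform a b c.
have Kf p : halfplane p -> dot (K p) (lingrad a b c p) = 0.
  case: p => x y Hp; have [-> _] := KE _ Hp; rewrite /halfplane /= in Hp.
  have y0 : y != 0 by rewrite gt_eqF.
  by rewrite /lingrad /linform /dot /=; field.
(* psi vanishes on the boundary, so its gradient is normal to it: K psi = 0 means
   that K is tangent to the boundary *)
have zeroP (p n : R * R) : bdry Omega p -> n != 0 ->
    (forall V, dot n V < 0 -> \forall t \near 0^'+, Omega (p + t *: V)) ->
    (derivative_along K grad_psi p = 0 <-> dot (K p) n = 0).
  move=> Bp n0 inw; have Hp := cOH _ Bp.1; have p2 : p.2 != 0 by rewrite gt_eqF.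
  have [l gl] : exists l, - grad_psi p = l *: n.
    apply: halfplane_duality n0 _ => V /inw.
    move=> /(gradient_inward psi_C1 psi_gt0 Bp (psi_bdry p Bp)).
    by rewrite {2}/dot /= !mulNr -opprD oppr_le0.
  have l0 : l != 0.
    apply: contraNneq (grad_bdry p Bp) => l0.
    by rewrite -oppr_eq0 gl l0 scale0r.
  have E : derivative_along K grad_psi p = - l / p.2 ^+ 2 * dot (K p) n.
    rewrite /derivative_along /metric -[grad_psi p]opprK gl.
    by case: (n) => x y; rewrite scale_pairE /dot /=; ring.
  rewrite E; split=> [/eqP|->]; last by rewrite mulr0.
  rewrite !mulf_eq0 oppr_eq0 (negPf l0) invr_eq0 expf_eq0 /= (negPf p2).
  by move=> /eqP.
have cf : {within closure Omega, continuous f}.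
  apply/subspace_continuousP => p cp; apply: cvg_linform; do ?exact: cvg_cst.
    exact: cvg_within.
  by rewrite gt_eqF // cOH.
have cO0 : closure Omega !=set0 by exists q0; exact: subO.
have [M + Mmax] := compact_EVT_max cO0 cO cf; rewrite inE => cM.
have [m + mmin] := compact_EVT_min cO0 cO cf; rewrite inE => cm.
have {}Mmax q : closure Omega q -> f q <= f M.
  by move=> cq; apply: Mmax; rewrite inE.
have {}mmin q : closure Omega q -> f m <= f q.
  by move=> cq; apply: mmin; rewrite inE.
(* s = 1 is used for the maximum of f and s = - 1 for its minimum *)
have crit p s : s != 0 -> closure Omega p ->
    (forall q, closure Omega q -> s * f q <= s * f p) ->
    bdry Omega p /\ derivative_along K grad_psi p = 0.
  move=> s0 cp pmax; have Hp := cOH _ cp.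
  have s20 : 0 < s ^+ 2 by rewrite exprn_even_gt0.
  have Is : 0 < (s * b) ^+ 2 - 4 * (s * a) * (s * c).
    have -> : (s * b) ^+ 2 - 4 * (s * a) * (s * c) =
        s ^+ 2 * (b ^+ 2 - 4 * a * c) by ring.
    exact: mulr_gt0.
  have smax q : Omega q -> linform (s * a) (s * b) (s * c) q <=
      linform (s * a) (s * b) (s * c) p.
    by move=> Oq; rewrite !linformZ; apply: pmax; exact: subO.
  have Bp := linform_max_bdry oO cOH Is cp smax.
  have [n n0 [inw _]] := boundary_normal oO Osm Bp.
  have [l gl] := linform_max_normal OH Hp n0 inw smax.
  split=> //; apply/(zeroP p n Bp n0 inw).
  have l0 : l != 0.
    by apply: contraNneq (lingrad_neq0 Hp Is) => l0; rewrite gl l0 scale0r.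
  have := Kf p Hp; have sE := lingradZ s a b c p.
  move=> /(congr1 ( *%R s)); rewrite mulr0 -dotZr -sE gl dotZr => /eqP.
  by rewrite mulf_eq0 (negPf l0) => /eqP.
(* K is orthogonal to the gradients of f and of the supporting horoball, so the
   two are parallel and the horocycle is tangent to the level curve of f *)
have strict p : bdry Omega p -> derivative_along K grad_psi p = 0 ->
    exists l, forall z, closure Omega z -> z != p -> l * (f z - f p) < 0.
  move=> Bp; have Hp := cOH _ Bp.1.
  have [n n0 [inw cc]] := boundary_normal oO Osm Bp.
  move=> /(zeroP p n Bp n0 inw) Kn.
  have [w w1 wmax] := supporting_horoball Omega_horoconvex cOH Hp cc.
  have [l' hl'] :=
    linform_max_normal OH Hp n0 inw (fun q Oq => wmax q (subO q Oq)).
  have [k nk] :=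
    dot_orthogonal_parallel (K0 p Hp) (lingrad_neq0 Hp I0) (Kf p Hp) Kn.
  exists (l' * k) => z cz zp.
  have BAC : (w.1 * w.2) ^+ 2 = w.1 ^+ 2 * w.2 ^+ 2 by rewrite exprMn.
  apply: (tangent_horocycle_extremum I0 BAC Hp (cOH _ cz) zp
    (horolevel_gt0 w1 Hp) (wmax z cz)).
  by rewrite hl' nk scalerA.
have [BM ZM] : bdry Omega M /\ derivative_along K grad_psi M = 0.
  by apply: (crit M 1) => // q cq; rewrite !mul1r; exact: Mmax.
have [Bm Zm] : bdry Omega m /\ derivative_along K grad_psi m = 0.
  by apply: (crit m (-1)) => // q cq; rewrite !mulN1r lerN2; exact: mmin.
have Mm : M <> m.
  move=> Mm; have [l hl] := strict M BM ZM.
  have q0M : q0 != M.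
    apply: contra_notN BM.2 => /eqP <-.
    by rewrite (proj1 (interior_id _) oO).
  have := hl q0 (subO _ Oq0) q0M.
  have -> : f q0 = f M.
    by apply/eqP; rewrite eq_le Mmax ?[in X in X <= _]Mm ?mmin //; exact: subO.
  by rewrite subrr mulr0 ltxx.
suff -> : [set p | bdry Omega p /\ derivative_along K grad_psi p = 0] = [set M; m].
  exact: card_set2_eq2.
apply/seteqP; split=> [p [Bp Zp]|p [->|->]] //=.
apply: contrapT => /not_orP[pM pm].
have [l hl] := strict p Bp Zp.
have hM := hl M cM; have hm := hl m cm.
have lM : l * (f M - f p) < 0 by apply: hM; apply/eqP => e; apply: pM.
have lm : l * (f m - f p) < 0 by apply: hm; apply/eqP => e; apply: pm.
have Mp : 0 <= f M - f p by rewrite subr_ge0 Mmax //; exact: Bp.1.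
have mp : f m - f p <= 0 by rewrite subr_le0 mmin //; exact: Bp.1.
have [l0|l0] := leP 0 l.
  by have := mulr_ge0 l0 Mp; rewrite leNgt lM.
by have := mulr_le0 (ltW l0) mp; rewrite leNgt lm.
Qed.
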